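(* Let $\beta=(B,(B_i)_{i\in I_\beta})$ be a regular hypertope with $I_\beta=\{1,\ldots,n\}$ and distinguished generators $b_1,\ldots,b_n$, so $B=\langle b_i\mid i\in I_\beta\rangle$. Fix $j\in I_\beta$, assume that $X_j=\{\sigma B_j\mid\sigma\in B\}$ is finite and has at least two elements, and let $\mathcal{D}=\mathcal{D}(\beta,j,\lambda)$ be a $j$-diagonal Coxeter graph for a label function $\lambda:\mathcal{C}^j_\beta\to\{2,3,\ldots\}\cup\{\infty\}$. Let $A=W(\mathcal{D})$, generated by $\{a_F\mid F\in V(\mathcal{D})\}$, let $\alpha$ be its standard coset incidence system, and set $F_L=B_j$. Then the Coxeter diagram of the hypertope $\mathcal{T}(\alpha,\beta)$ is obtained from the Coxeter diagram of $\beta$ (with vertices $1,\ldots,n$, and all its edges and labels kept) by adding one new vertex $0$ (corresponding to $a_{B_j}$), joined to the vertex $j$ by an edge labelled $2m$ and to no other vertex, where $m=\lambda([B_j,b_jB_j])$ (and $2m=\infty$ if $m=\infty$).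
   Context: Coset incidence systems. Given a group $B$ and a family $(B_i)_{i\in I_\beta}$ of subgroups (the maximal parabolic subgroups), the coset incidence system $\beta=(B,(B_i)_{i\in I_\beta})$ has as elements of type $i$ the left cosets $bB_i$; two cosets are incident if they intersect. $B$ acts by left multiplication. For $J\subseteq I_\beta$, $B_J=\bigcap_{i\in J}B_i$ and $B_\emptyset=B$. A flag is a set of pairwise incident elements (distinct incident elements have different types), a chamber is a flag with an element of every type, and the system is an incidence geometry if every maximal flag is a chamber. Regular hypertopes. A regular hypertope is an incidence geometry that is thin (every rank-one residue has exactly two elements), residually connected (every residue of rank at least two has connected incidence graph), and has a flag-transitive automorphism group. When a coset incidence system $(B,(B_i)_{i\in I_\beta})$ is called a regular hypertope, $B$ itself is its (type-preserving) automorphism group, i.e. $B$ acts faithfully and flag-transitively. Its distinguished generators are the involutions $b_i$ with $B_{I_\beta\setminus\{i\}}=\langle b_i\rangle$; they generate $B$. Its Coxeter diagram is the labelled graph on these generators (indexed by the types) in which the label between $i\neq k$ is the order of $b_ib_k$, edges with label $2$ being omitted. Diagonals. A $j$-diagonal is an unordered pair $\{F_1,F_2\}$ of distinct elements of $X_j$. Two $j$-diagonals are equivalent if some $b\in B$ maps one to the other (as unordered pairs). The class is $[F_1,F_2]$, and $\mathcal{C}^j_\beta$ is the set of all classes. Diagonal Coxeter graph. $\mathcal{D}(\beta,j,\lambda)$ has vertex set $V(\mathcal{D})=X_j$; distinct $F_1,F_2$ are joined by an edge iff $\lambda([F_1,F_2])\neq 2$, and the edge is then labelled $\lambda([F_1,F_2])$.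 $W(\mathcal{D})$ is generated by $a_F$ ($F\in X_j$) with defining relations $a_F^2=1$ and $(a_Fa_E)^{\lambda([F,E])}=1$ for $F\ne E$ with $\lambda([F,E])<\infty$. Set $A_F=\langle a_E\mid E\in X_j\setminus\{F\}\rangle$; the standard coset incidence system is $\alpha=(A,(A_F)_{F\in X_j})$. The action $\eta:B\to\operatorname{Aut}(A)$ is given by $\eta(b)(a_F)=a_{bF}$; $B$ has the unique orbit $L=X_j$ on the types of $\alpha$. Twisting (for one orbit $L=X_j$ with representative $F_L=B_j$). $\mathcal{T}(\alpha,\beta)=(G,(G_i)_{i\in I_\beta\sqcup\{L\}})$ with $G=A\rtimes_\eta B$, $G_i=A_{L\setminus (B_i\cdot F_L)}\rtimes B_i$ for $i\in I_\beta$, and $G_L=A_L\rtimes B$, where $A_J=\bigcap_{F\in J}A_F$ for $J\subseteq X_j$ and $A_\emptyset=A$. It is a regular hypertope; the type $L$ is renamed $0$. *)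

(* Defs.v *)
(* The groups at hand may be infinite: they are [groupType]s, and their subsets
   are classical sets. *)
From HB Require Import structures.
From mathcomp Require Import all_boot.
From mathcomp Require Import boolp classical_sets cardinality.
From Stdlib Require Import Relation_Operators.

Set Implicit Arguments.
Unset Strict Implicit.
Unset Printing Implicit Defensive.

Local Open Scope classical_set_scope.
Local Open Scope quotient_scope.
Local Open Scope group_scope.

Variant label := Fin of nat | Infty.

Definition label_ge2 (l : label) : Prop := if l is Fin m then (2 <= m)%N else True.

Definition double_label (l : label) : label :=
  if l is Fin m then Fin m.*2 else Infty.

(* [D x y = None] means that x and y are not joined. *)
Definition lgraph (V : Type) := V -> V -> option label.

(* In Coxeter diagrams, edges with label 2 are omitted. *)
Definition edge_of_label (l : label) : option label :=
  if l is Fin 2 then None else Some l.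

Definition label_of_edge (e : option label) : label := odflt (Fin 2) e.

(* The new vertex is [None]; it is joined to [j] only, by an edge labelled [l]. *)
Definition add_vertex (V : eqType) (D : lgraph V) (j : V) (l : label) :
    lgraph (option V) := fun s t =>
  match s, t with
  | Some i, Some k => D i k
  | None, Some k | Some k, None => if k == j then Some l else None
  | None, None => None
  end.

Definition subgroup (G : groupType) (H : set G) : Prop :=
  [/\ H 1, forall x y, H x -> H y -> H (x * y) & forall x, H x -> H x^-1].

Definition generated (G : groupType) (S : set G) : set G :=
  smallest (@subgroup G) S.

Definition elt_order (G : groupType) (g : G) : label :=
  match pselect (exists n, (0 < n)%N && (g ^+ n == 1)) with
  | left P => Fin (ex_minn P)
  | right _ => Infty
  end.

Lemma generated_subgroup (G : groupType) (S : set G) : subgroup (generated S).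
Proof.
split=> [|x y Hx Hy|x Hx] H cH; have [[H1 HM HV] _] := cH; first exact: H1.
- by apply: HM; [apply: Hx cH | apply: Hy cH].
- by apply: HV; apply: Hx cH.
Qed.

Section Presented.
Variable X : choiceType.

(* The letter (x, true) stands for x^-1. *)
Definition word := seq (X * bool).

Inductive word_cong (R : set word) : word -> word -> Prop :=
| Wrefl u : word_cong R u u
| Wsym u v : word_cong R u v -> word_cong R v u
| Wtrans u v w : word_cong R u v -> word_cong R v w -> word_cong R u w
| Wcat u u' v v' :
    word_cong R u u' -> word_cong R v v' -> word_cong R (u ++ v) (u' ++ v')
| Wcancel x e : word_cong R [:: (x, e); (x, ~~ e)] [::]
| Wrel r : R r -> word_cong R r [::].

Variable R : set word.

Definition word_eq : rel word := fun u v => `[< word_cong R u v >].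

Lemma word_eq_equiv : equiv_class_of word_eq.
Proof.
split=> [u|u v|v u w]; first exact/asboolP/Wrefl.
  by apply/asboolP/asboolP; apply: Wsym.
by move=> /asboolP uv /asboolP vw; apply/asboolP; apply: Wtrans uv vw.
Qed.

Canonical word_equiv := EquivRelPack word_eq_equiv.

Definition presented := {eq_quot word_eq}.
HB.instance Definition _ := Choice.on presented.

Definition of_word (w : word) : presented := \pi_presented w.

Lemma of_wordP u v : of_word u = of_word v <-> word_cong R u v.
Proof.
split; first by move/eqmodP/asboolP.
by move=> uv; apply/eqmodP/asboolP.
Qed.

Lemma of_wordK (x : presented) : of_word (repr x) = x.
Proof. exact: reprK. Qed.

Lemma repr_of_word w : word_cong R (repr (of_word w)) w.
Proof. by apply/of_wordP; rewrite of_wordK. Qed.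

Definition inv_word (w : word) : word := rev [seq (x.1, ~~ x.2) | x <- w].

Lemma inv_word_cat u v : inv_word (u ++ v) = inv_word v ++ inv_word u.
Proof. by rewrite /inv_word map_cat rev_cat. Qed.

Lemma inv_wordK : involutive inv_word.
Proof.
move=> w; rewrite /inv_word map_rev revK -map_comp -[RHS]map_id.
by apply: eq_map => -[x e] /=; rewrite negbK.
Qed.

Lemma cat_inv_word w : word_cong R (w ++ inv_word w) [::].
Proof.
elim: w => [|[x e] w IH]; first exact: Wrefl.
have -> : ((x, e) :: w) ++ inv_word ((x, e) :: w) =
  [:: (x, e)] ++ (w ++ inv_word w) ++ [:: (x, ~~ e)].
  by rewrite -[_ :: w]cat1s inv_word_cat -!catA.
apply: Wtrans (Wcancel R x e).
apply: (@Wcat R [:: (x, e)] [:: (x, e)] _ [:: (x, ~~ e)]); first exact: Wrefl.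
by rewrite -[X in word_cong _ _ X]cat0s; apply: Wcat; [|exact: Wrefl].
Qed.

Lemma inv_word_cong u v :
  word_cong R u v -> word_cong R (inv_word u) (inv_word v).
Proof.
move=> uv; have h : word_cong R (inv_word u ++ v) [::].
  apply: Wtrans (Wcat (Wrefl _ _) (Wsym uv)) _.
  by rewrite -{2}(inv_wordK u); exact: cat_inv_word.
apply: Wtrans (_ : word_cong R _ (inv_word u ++ (v ++ inv_word v))) _.
  rewrite -{1}[inv_word u]cats0; apply: Wcat (Wrefl _ _) (Wsym _).
  exact: cat_inv_word.
by rewrite catA -[X in word_cong _ _ X]cat0s; apply: Wcat h (Wrefl _ _).
Qed.

Definition presented_mul (x y : presented) := of_word (repr x ++ repr y).
Definition presented_inv (x : presented) := of_word (inv_word (repr x)).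
Definition presented_one : presented := of_word [::].

Lemma mul_of_word u v : presented_mul (of_word u) (of_word v) = of_word (u ++ v).
Proof. by apply/of_wordP; apply: Wcat; exact: repr_of_word. Qed.

Lemma presented_mulA : associative presented_mul.
Proof.
move=> x y z; rewrite -(of_wordK x) -(of_wordK y) -(of_wordK z).
by rewrite !mul_of_word catA.
Qed.

Lemma presented_mul1 : left_id presented_one presented_mul.
Proof. by move=> x; rewrite -(of_wordK x) mul_of_word. Qed.

Lemma presented_mulr1 : right_id presented_one presented_mul.
Proof. by move=> x; rewrite -(of_wordK x) mul_of_word cats0. Qed.

Lemma presented_mulV : right_inverse presented_one presented_inv presented_mul.
Proof.
move=> x; rewrite /presented_inv -{1}(of_wordK x) mul_of_word.
by apply/of_wordP; exact: cat_inv_word.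
Qed.

Lemma presented_Vmul : left_inverse presented_one presented_inv presented_mul.
Proof.
move=> x; rewrite /presented_inv -{2}(of_wordK x) mul_of_word.
by apply/of_wordP; rewrite -{2}(inv_wordK (repr x)); exact: cat_inv_word.
Qed.

HB.instance Definition _ := isGroup.Build presented presented_mulA
  presented_mul1 presented_mulr1 presented_Vmul presented_mulV.

Definition presented_gen (x : X) : presented := of_word [:: (x, false)].

Definition map_word (f : X -> X) (w : word) : word :=
  [seq (f x.1, x.2) | x <- w].

(* The endomorphism sending each generator x to f x, when f maps
   relators to relators; [map_presentedM] and [map_presented_gen] characterize it. *)
Definition map_presented (f : X -> X) (x : presented) : presented :=
  of_word (map_word f (repr x)).

Section Map.
Variables (f : X -> X) (fR : forall r, R r -> R (map_word f r)).

Lemma map_word_cong u v :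
  word_cong R u v -> word_cong R (map_word f u) (map_word f v).
Proof.
elim=> {u v} [u|u v _|u v w _ uv _ vw|u u' v v' _ uu' _ vv'|x e|r /fR].
- exact: Wrefl.
- exact: Wsym.
- exact: Wtrans uv vw.
- by rewrite /map_word !map_cat; apply: Wcat.
- exact: Wcancel.
- exact: Wrel.
Qed.

Lemma map_of_word w : map_presented f (of_word w) = of_word (map_word f w).
Proof. by apply/of_wordP/map_word_cong/repr_of_word. Qed.

Lemma map_presentedM x y :
  map_presented f (x * y) = map_presented f x * map_presented f y.
Proof.
rewrite -(of_wordK x) -(of_wordK y) [_ * _]mul_of_word !map_of_word.
by rewrite [RHS]mul_of_word /map_word map_cat.
Qed.

Lemma map_presented_gen x : map_presented f (presented_gen x) = presented_gen (f x).
Proof. by rewrite /presented_gen map_of_word. Qed.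

End Map.

End Presented.

Section Coxeter.
Variables (X : choiceType) (D : lgraph X).

Definition alternating (x y : X) (m : nat) : word X :=
  flatten (nseq m [:: (x, false); (y, false)]).

Definition coxeter_relators : set (word X) :=
  [set w | (exists x, w = [:: (x, false); (x, false)]) \/
           (exists x y m, [/\ x <> y, label_of_edge (D x y) = Fin m &
                             w = alternating x y m])].

Definition coxeter_group := presented coxeter_relators.
HB.instance Definition _ := Group.on coxeter_group.

Definition coxeter_gen (x : X) : coxeter_group := presented_gen _ x.

Lemma map_coxeter_relators (f : X -> X) :
    injective f -> (forall x y, D (f x) (f y) = D x y) ->
  forall r, coxeter_relators r -> coxeter_relators (map_word f r).
Proof.
move=> fI fD r [[x ->]|[x [y [m [xy Dm ->]]]]]; first by left; exists (f x).
right; exists (f x), (f y), m; rewrite fD; split=> //; first by move/fI.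
by rewrite /alternating /map_word map_flatten map_nseq.
Qed.

End Coxeter.

(* Actions of B on A by automorphisms, i.e. homomorphisms B -> Aut(A). *)
Record aut_action (B A : groupType) := AutAction {
  aut_act :> B -> A -> A;
  aut_act1 : forall x, aut_act 1 x = x;
  aut_actM : forall b c x, aut_act (b * c) x = aut_act b (aut_act c x);
  aut_actMr : forall b x y, aut_act b (x * y) = aut_act b x * aut_act b y }.

(* The pair (x, b) stands for the product x b. *)
Definition sdprod (B A : groupType) (eta : aut_action B A) : Type := (A * B)%type.

Section SemidirectProduct.
Variables (B A : groupType) (eta : aut_action B A).
Local Notation sdprod := (sdprod eta).

HB.instance Definition _ := Choice.copy sdprod (A * B)%type.

Lemma aut_actr1 b : eta b 1 = 1.
Proof.
by apply: (mulgI (eta b 1)); rewrite -aut_actMr !mulg1.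
Qed.

Lemma aut_actV b x : eta b x^-1 = (eta b x)^-1.
Proof.
by apply: (mulgI (eta b x)); rewrite -aut_actMr !mulgV aut_actr1.
Qed.

Definition sdprod_mul (g h : sdprod) : sdprod :=
  (g.1 * eta g.2 h.1, g.2 * h.2).
Definition sdprod_inv (g : sdprod) : sdprod := (eta g.2^-1 g.1^-1, g.2^-1).
Definition sdprod_one : sdprod := (1, 1).

Lemma sdprod_mulA : associative sdprod_mul.
Proof.
by move=> g h k; rewrite /sdprod_mul /= aut_actMr aut_actM !mulgA.
Qed.

Lemma sdprod_mul1 : left_id sdprod_one sdprod_mul.
Proof. by case=> a b; rewrite /sdprod_mul /= aut_act1 !mul1g. Qed.

Lemma sdprod_mulr1 : right_id sdprod_one sdprod_mul.
Proof. by case=> a b; rewrite /sdprod_mul /= aut_actr1 !mulg1. Qed.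

Lemma sdprod_Vmul : left_inverse sdprod_one sdprod_inv sdprod_mul.
Proof.
by case=> a b; rewrite /sdprod_mul /= -aut_actMr !mulVg aut_actr1.
Qed.

Lemma sdprod_mulV : right_inverse sdprod_one sdprod_inv sdprod_mul.
Proof.
by case=> a b; rewrite /sdprod_mul /= -aut_actM !mulgV aut_act1 mulgV.
Qed.

HB.instance Definition _ := isGroup.Build sdprod sdprod_mulA sdprod_mul1
  sdprod_mulr1 sdprod_Vmul sdprod_mulV.

Lemma sdprod_subgroup (H : set A) (K : set B) :
    subgroup H -> subgroup K -> (forall b x, K b -> H x -> H (eta b x)) ->
  subgroup [set g : sdprod | H g.1 /\ K g.2].
Proof.
move=> [H1 HM HV] [K1 KM KV] KH; split=> [|g h [Hg Kg] [Hh Kh]|g [Hg Kg]] /=.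
- by [].
- by split; [apply: HM => //; apply: KH | apply: KM].
- by split; [apply: KH; [apply: KV | apply: HV] | apply: KV].
Qed.

End SemidirectProduct.

Record incidence_system (I : Type) := IncidenceSystem {
  elt :> Type;
  type_of : elt -> I;
  incident : elt -> elt -> Prop }.

Section Incidence.
Variables (I : Type) (S : incidence_system I).

Definition flag (F : set S) : Prop :=
  forall x y, F x -> F y -> incident x y.

Definition flag_type (F : set S) : set I := @type_of I S @` F.

Definition chamber (F : set S) : Prop := flag F /\ flag_type F = setT.

Definition maximal_flag (F : set S) : Prop :=
  flag F /\ forall F', flag F' -> F `<=` F' -> F' = F.

Definition incidence_geometry : Prop :=
  forall F, maximal_flag F -> chamber F.

Definition residue (F : set S) : set S :=
  [set x | ~ F x /\ forall y, F y -> incident x y].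

(* The rank of the residue of F is the size of this set of types. *)
Definition cotype (F : set S) : set I := ~` flag_type F.

Definition thin : Prop :=
  forall F i, flag F -> cotype F = [set i] ->
  exists x y, x <> y /\ residue F = [set x; y].

Definition connected_within (E : set S) : Prop :=
  forall x y, E x -> E y ->
  clos_refl_trans S (fun u v => [/\ E u, E v & incident u v]) x y.

Definition residually_connected : Prop :=
  forall F i k, flag F -> cotype F i -> cotype F k -> i <> k ->
  connected_within (residue F).

End Incidence.

Record coset_system (B : groupType) (I : Type) := CosetSystem {
  maxparabolic :> I -> set B;
  maxparabolic_subgroup : forall i, subgroup (maxparabolic i) }.

Section CosetSystem.
Variables (B : groupType) (I : Type) (beta : coset_system B I).

Definition left_coset (b : B) (H : set B) : set B := [set b * h | h in H].

Definition parabolic (J : set I) : set B := \bigcap_(i in J) beta i.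

Lemma parabolic_subgroup J : subgroup (parabolic J).
Proof.
split=> [i _|x y Hx Hy i Ji|x Hx i Ji]; have [H1 HM HV] := maxparabolic_subgroup beta i.
- by [].
- by apply: HM; [apply: Hx | apply: Hy].
- by apply: HV; apply: Hx.
Qed.

Definition cosets (i : I) : set (set B) := [set left_coset b (beta i) | b in setT].

(* The carrier of X_i. *)
Definition cosetsType (i : I) : choiceType := set_type (cosets i).

Lemma left_cosetM b c H : left_coset b (left_coset c H) = left_coset (b * c) H.
Proof.
apply/seteqP; split=> [x [y [h Hh <-] <-]|x [h Hh <-]].
  by exists h => //; rewrite mulgA.
by exists (c * h); [exists h | rewrite mulgA].
Qed.

Lemma left_coset1 H : left_coset 1 H = H.
Proof.
apply/seteqP; split=> [x [h Hh <-]|x Hx]; first by rewrite mul1g.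
by exists x => //; rewrite mul1g.
Qed.

Lemma act_subproof i b (F : cosetsType i) : left_coset b (val F) \in cosets i.
Proof.
have [c _ eF] := set_mem (valP F); apply: mem_set; exists (b * c) => //.
by rewrite -eF left_cosetM.
Qed.

Definition act i (b : B) (F : cosetsType i) : cosetsType i := SigSub (act_subproof b F).

Lemma base_subproof i : beta i \in cosets i.
Proof. by apply: mem_set; exists 1 => //; rewrite left_coset1. Qed.

Definition base (i : I) : cosetsType i := SigSub (base_subproof i).

Lemma act1 i (F : cosetsType i) : act 1 F = F.
Proof. by apply: val_inj; rewrite /= left_coset1. Qed.

Lemma actM i b c (F : cosetsType i) : act (b * c) F = act b (act c F).
Proof. by apply: val_inj; rewrite /= left_cosetM. Qed.

Lemma actK i b : cancel (@act i b) (act b^-1).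
Proof. by move=> F; rewrite -actM mulVg act1. Qed.

Lemma actKV i b : cancel (@act i b^-1) (act b).
Proof. by move=> F; rewrite -actM mulgV act1. Qed.

Definition coset_incidence : incidence_system I :=
  @IncidenceSystem I {i : I & cosetsType i} (fun x => projT1 x)
    (fun x y => val (projT2 x) `&` val (projT2 y) !=set0).

Definition act_elt (b : B) (x : coset_incidence) : coset_incidence :=
  existT _ (projT1 x) (act b (projT2 x)).

Definition flag_transitive : Prop :=
  forall F1 F2 : set coset_incidence, flag F1 -> flag F2 ->
  flag_type F1 = flag_type F2 -> exists b, act_elt b @` F1 = F2.

Definition faithful : Prop :=
  forall b, (forall x, act_elt b x = x) -> b = 1.

Definition regular_hypertope : Prop :=
  [/\ incidence_geometry coset_incidence, thin coset_incidence,
      residually_connected coset_incidence, flag_transitive & faithful].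

Definition distinguished_generators (b : I -> B) : Prop :=
  forall i, elt_order (b i) = Fin 2 /\
            parabolic [set k | k <> i] = generated [set b i].

End CosetSystem.

Definition coxeter_diagram (G : groupType) (I : eqType) (g : I -> G) : lgraph I :=
  fun i k => if i == k then None else edge_of_label (elt_order (g i * g k)).

Section Twisting.
Variables (B : groupType) (I : Type) (beta : coset_system B I) (j : I).
Local Notation Xj := (cosetsType beta j).

(* The class [F1, F2]: the set of all diagonals {b F1, b F2}. *)
Definition diagonal_class (F1 F2 : Xj) : set (set Xj) :=
  [set [set act b F1; act b F2] | b in setT].

Definition diagonal_classes : set (set (set Xj)) :=
  [set c | exists F1 F2, F1 <> F2 /\ c = diagonal_class F1 F2].

(* A label function is only relevant on the classes of diagonals; its values
   elsewhere are never used. *)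
Variable lambda : set (set Xj) -> label.

Definition label_function : Prop :=
  forall c, diagonal_classes c -> label_ge2 (lambda c).

Definition diagonal_graph : lgraph Xj := fun F1 F2 =>
  if F1 == F2 then None else edge_of_label (lambda (diagonal_class F1 F2)).

Lemma diagonal_class_act b F1 F2 :
  diagonal_class (act b F1) (act b F2) = diagonal_class F1 F2.
Proof.
apply/seteqP; split=> c [d _ <-].
  by exists (d * b) => //; rewrite !actM.
by exists (d * b^-1) => //; rewrite !actM !actK.
Qed.

Lemma act_inj (b : B) : injective (@act B I beta j b).
Proof. exact: can_inj (@actK B I beta j b). Qed.

Lemma diagonal_graph_act b F1 F2 :
  diagonal_graph (act b F1) (act b F2) = diagonal_graph F1 F2.
Proof. by rewrite /diagonal_graph (inj_eq (@act_inj b)) diagonal_class_act. Qed.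

Definition twistA : groupType := coxeter_group diagonal_graph.

Lemma eta_relators b (r : word Xj) : coxeter_relators diagonal_graph r ->
  coxeter_relators diagonal_graph (map_word (act b) r).
Proof.
by apply: map_coxeter_relators; [exact: act_inj | exact: diagonal_graph_act].
Qed.

Definition eta_fun (b : B) : twistA -> twistA :=
  @map_presented Xj (coxeter_relators diagonal_graph) (act b).

Lemma eta1 x : eta_fun 1 x = x.
Proof.
rewrite -(of_wordK x) /eta_fun (map_of_word (eta_relators 1)).
congr of_word; rewrite -[RHS]map_id.
by apply: eq_map => -[y e] /=; rewrite act1.
Qed.

Lemma etaM b c x : eta_fun (b * c) x = eta_fun b (eta_fun c x).
Proof.
rewrite -(of_wordK x) /eta_fun (map_of_word (eta_relators (b * c))).
rewrite (map_of_word (eta_relators c)) (map_of_word (eta_relators b)).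
congr of_word; rewrite /map_word -map_comp.
by apply: eq_map => -[y e] /=; rewrite actM.
Qed.

Lemma etaMr b x y : eta_fun b (x * y) = eta_fun b x * eta_fun b y.
Proof. exact: (map_presentedM (eta_relators b)). Qed.

Definition eta : aut_action B twistA := AutAction eta1 etaM etaMr.

Lemma eta_gen b F : eta b (coxeter_gen _ F) = coxeter_gen _ (act b F).
Proof. exact: (map_presented_gen (eta_relators b)). Qed.

Definition alpha : coset_system twistA Xj :=
  @CosetSystem twistA Xj
    (fun F => generated [set coxeter_gen diagonal_graph E | E in [set E | E <> F]])
    (fun F => generated_subgroup _).

Definition coset_orbit (H : set B) (F : Xj) : set Xj := [set act b F | b in H].

Lemma eta_alpha b F x : alpha F x -> alpha (act b F) (eta b x).
Proof.
move=> Fx H [sH SH]; have [H1 HM HV] := sH.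
apply: (Fx [set y | H (eta b y)]); split.
  split=> [|y z Hy Hz|y Hy]; rewrite /mkset; first by rewrite (aut_actr1 eta b).
    by rewrite (aut_actMr eta b); apply: HM.
  by rewrite (aut_actV eta b); apply: HV.
move=> _ [E EF <-]; rewrite /mkset eta_gen; apply: SH; exists (act b E) => //=.
by move/act_inj.
Qed.

Lemma eta_parabolic (J : set Xj) b x :
    (forall F, J F -> J (act b^-1 F)) ->
  parabolic alpha J x -> parabolic alpha J (eta b x).
Proof.
move=> JK Jx F JF; rewrite -(actKV b F).
by apply: eta_alpha; apply: Jx; apply: JK.
Qed.

Lemma orbitC_stable (H : set B) F b : subgroup H -> H b ->
  forall E, (~` coset_orbit H F) E -> (~` coset_orbit H F) (act b^-1 E).
Proof.
move=> [H1 HM HV] Hb E nE [c Hc cE]; apply: nE; exists (b * c); first exact: HM.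
by rewrite actM cE actKV.
Qed.

Definition twistG : groupType := sdprod eta.

(* The types of the twisting are those of beta together with [None], which is
   the type L (renamed 0). *)
Definition twist_maxparabolic (t : option I) : set twistG :=
  if t is Some i then
    [set g : sdprod eta | parabolic alpha (~` coset_orbit (beta i) (base beta j)) g.1 /\
             beta i g.2]
  else [set g : sdprod eta | parabolic alpha setT g.1 /\ [set: B] g.2].

Lemma twist_maxparabolic_subgroup t : subgroup (twist_maxparabolic t).
Proof.
case: t => [i|]; apply: sdprod_subgroup.
- exact: parabolic_subgroup.
- exact: maxparabolic_subgroup.
- move=> b x Hb; apply: eta_parabolic; apply: orbitC_stable => //.
  exact: maxparabolic_subgroup.
- exact: parabolic_subgroup.
- by [].
- by move=> b x _; apply: eta_parabolic.
Qed.

Definition twisting : coset_system twistG (option I) :=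
  CosetSystem twist_maxparabolic_subgroup.

End Twisting.

(* Main.v *)
Require Import Defs.
From mathcomp Require Import all_boot all_order all_algebra all_field.
From mathcomp Require Import ring.
From mathcomp Require Import boolp classical_sets cardinality.

(** The distinguished generators of the twisting are [(a, 1)], with [a] the
    Coxeter generator of the base element [B_j], and the [(1, b i)]. The orders
    of products are easy to relate to those in [B] and in the Coxeter group:
    the order of [(1, b i) * (1, b k)] is that of [b i * b k]; if [i] is not
    [j], then [b i] fixes the base element, hence commutes with [a]; and the
    square of [(a, b j)] is [a * a'], where [a'] is the generator of the image
    of the base element by [b j], so that its order is twice that of [a * a']
    ([elt_order_sdprod_involution]). That image differs from the base element
    because [b j] is not in [B_j] ([distinguished_notin]), a consequence of
    thinness and flag-transitivity.

    Two facts on a Coxeter group [W] are needed. The first one is that the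
    product of two generators has exactly the prescribed order
    ([elt_order_coxeter_gen2]). The group [W] acts on complex functions on the
    generators by the dual of the reflection representation; the product of two
    generators then acts on their two coordinates with eigenvalues [z ^+ 2] and
    [z ^- 2], where [z] is a primitive [2m]-th root of unity if the label is
    [m], and has infinite order otherwise.

    The second one is that an intersection of standard parabolic subgroups is
    the standard parabolic subgroup on the intersection of the sets of
    generators ([standard_parabolic_bigcap]); it identifies the parabolic
    subgroups of rank one of the twisting. It comes from the action of [W] on
    signed reflections, which defines the inversions of an element and gives
    the exchange condition. The last letter of a shortest word of [w] is an
    inversion of [w], and the inversions of an element of a standard parabolic
    subgroup belong to that subgroup ([standard_parabolic_inversion]). Hence all
    letters of the word are generators of each standard parabolic subgroup that
    contains [w], because a generator lies in such a subgroup only when its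
    index belongs to the corresponding set
    ([coxeter_gen_standard_parabolic]). *)

Set Implicit Arguments.
Unset Strict Implicit.
Unset Printing Implicit Defensive.

Local Open Scope classical_set_scope.
Local Open Scope group_scope.

(** * Orders of elements and generated subgroups *)

(** Coding the label [Infty] by 0 turns the powers that kill an element into
    the multiples of a single number, because 0 divides only 0. *)
Definition period (l : label) : nat := if l is Fin m then m else 0.

Lemma period_double l : period (double_label l) = (period l).*2.
Proof. by case: l. Qed.

Lemma elt_order_period (G : groupType) (g : G) k :
  (g ^+ k == 1) = (period (elt_order g) %| k)%N.
Proof.
rewrite /elt_order; case: pselect => [ex|nex] /=.
  case: ex_minnP => m /andP[m0 /eqP gm] mmin.
  rewrite {1}(divn_eq k m) expgnDr mulnC expgnA gm expg1n mul1g /dvdn.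
  apply/idP/eqP => [gr|->]; last by rewrite expg0.
  apply/eqP; rewrite -leqn0 leqNgt; apply/negP => r0.
  by have := mmin _ (introT andP (conj r0 gr)); rewrite leqNgt ltn_mod m0.
rewrite dvd0n; case: k => [|k]; first by rewrite expg0 !eqxx.
by apply/negP => gk; apply: nex; exists k.+1.
Qed.

Lemma elt_order_neq0 (G : groupType) (g : G) : elt_order g <> Fin 0.
Proof.
rewrite /elt_order; case: pselect => [ex|//] [].
by case: ex_minnP => m /andP[]; case: m.
Qed.

Lemma period_inj l l' : l <> Fin 0 -> l' <> Fin 0 ->
  (forall k, (period l %| k) = (period l' %| k))%N -> l = l'.
Proof.
move=> l0 l'0 h; have eqp : period l = period l'.
  by apply/eqP; rewrite eqn_dvd h dvdnn -h dvdnn.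
by case: l l' l0 l'0 eqp {h} => [m|] [m'|] //= m0 m'0 eqm; congruence.
Qed.

Lemma elt_order_charact (G : groupType) (g : G) l : l <> Fin 0 ->
  (forall k, (g ^+ k == 1) = (period l %| k)%N) -> elt_order g = l.
Proof.
move=> l0 h; apply: period_inj => // [|k]; first exact: elt_order_neq0.
by rewrite -elt_order_period h.
Qed.

Lemma eq_elt_order (G H : groupType) (g : G) (h : H) :
  (forall k, (g ^+ k == 1) = (h ^+ k == 1)) -> elt_order g = elt_order h.
Proof.
move=> gh; apply: elt_order_charact => [|k]; first exact: elt_order_neq0.
by rewrite gh elt_order_period.
Qed.

(** The elements [g * h] and [h * g] are conjugate. *)
Lemma elt_order_mulC (G : groupType) (g h : G) :
  elt_order (g * h) = elt_order (h * g).
Proof.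
have imp (a c : G) k : (a * c) ^+ k = 1 -> (c * a) ^+ k = 1.
  have shift : (c * a) ^+ k * c = c * (a * c) ^+ k.
    elim: k => [|k IH]; first by rewrite !expg0 mul1g mulg1.
    by rewrite !expgS -mulgA IH !mulgA.
  by move=> ack; apply: (mulIg c); rewrite shift ack mulg1 mul1g.
by apply: eq_elt_order => k; apply/eqP/eqP; apply: imp.
Qed.

Lemma elt_order2P (G : groupType) (g : G) :
  elt_order g = Fin 2 <-> g <> 1 /\ g * g = 1.
Proof.
split=> [g2|[g1 gg]].
  split=> [/eqP|]; first by rewrite -(expg1 g) elt_order_period g2.
  by apply/eqP; rewrite -expg2 elt_order_period g2.
apply: elt_order_charact => // k /=.
rewrite -{1}(odd_double_half k) -muln2 mulnC expgnDr expgnA [g ^+ 2]expg2 gg.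
rewrite expg1n mulg1 dvdn2; case: (odd k); last by rewrite expg0 eqxx.
by rewrite expg1; apply/eqP.
Qed.

Lemma generated_sub (G : groupType) (S H : set G) :
  subgroup H -> S `<=` H -> generated S `<=` H.
Proof. by move=> sH SH x; apply. Qed.

Lemma sub_generated (G : groupType) (S : set G) : S `<=` generated S.
Proof. by move=> x Sx H [_]; apply. Qed.

Lemma generated_involution (G : groupType) (g x : G) : g * g = 1 ->
  generated [set g] x -> x = 1 \/ x = g.
Proof.
move=> gg; apply: (@generated_sub _ _ [set y | y = 1 \/ y = g]).
  have gV : g^-1 = g by apply: (mulgI g); rewrite mulgV gg.
  split=> [|y z [->|->] [->|->]|y [->|->]] /=; rewrite ?mul1g ?mulg1 ?gg ?invg1 ?gV;
    by [left | right].
by move=> _ ->; right.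
Qed.

(** * Actions of Coxeter groups *)

Section CoxeterAction.
Variables (X : choiceType) (D : lgraph X) (T : Type) (phi : X -> T -> T).
Local Notation W := (coxeter_group D).
Local Notation a := (coxeter_gen D).

Definition word_action (w : word X) (t : T) : T :=
  foldr (fun l => phi l.1) t w.

Lemma word_action_cat u v t :
  word_action (u ++ v) t = word_action u (word_action v t).
Proof. exact: foldr_cat. Qed.

Lemma word_action_alternating x y m t :
  word_action (alternating x y m) t = iter m (phi x \o phi y) t.
Proof. by elim: m => [|m IH] //=; rewrite -IH. Qed.

Hypothesis phiK : forall x, involutive (phi x).
Hypothesis phi_braid : forall x y m t, x <> y ->
  label_of_edge (D x y) = Fin m -> iter m (phi x \o phi y) t = t.

Lemma word_action_cong u v :
  word_cong (coxeter_relators D) u v -> word_action u =1 word_action v.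
Proof.
elim=> {u v} [u|u v _ IH|u v w _ uv _ vw|u u' v v' _ uu' _ vv'|x e|r Rr] t //.
- by rewrite uv vw.
- by rewrite !word_action_cat vv' uu'.
- exact: phiK.
- case: Rr => [[x ->]|[x [y [m [xy Dm ->]]]]]; first exact: phiK.
  by rewrite word_action_alternating (phi_braid _ xy Dm).
Qed.

Definition coxeter_action (w : W) (t : T) : T := word_action (repr w) t.

Lemma coxeter_action_of_word u t :
  coxeter_action (of_word (coxeter_relators D) u) t = word_action u t.
Proof. exact/word_action_cong/repr_of_word. Qed.

Lemma coxeter_action1 t : coxeter_action 1 t = t.
Proof. exact: coxeter_action_of_word. Qed.

Lemma coxeter_actionM v w t :
  coxeter_action (v * w) t = coxeter_action v (coxeter_action w t).
Proof. by rewrite [_ * _]/(of_word _ _) coxeter_action_of_word word_action_cat. Qed.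

Lemma coxeter_action_gen x t : coxeter_action (a x) t = phi x t.
Proof. exact: coxeter_action_of_word. Qed.

Lemma coxeter_actionX w k t : coxeter_action (w ^+ k) t = iter k (coxeter_action w) t.
Proof.
by elim: k => [|k IH]; rewrite ?coxeter_action1 // expgS coxeter_actionM IH.
Qed.

Lemma coxeter_action_stabilizer t : subgroup [set w | coxeter_action w t = t].
Proof.
split=> [|v w /= vt wt|w /= wt]; first exact: coxeter_action1.
  by rewrite coxeter_actionM wt.
by rewrite -{1}wt -coxeter_actionM mulVg coxeter_action1.
Qed.

End CoxeterAction.

Section CoxeterGenerators.
Variables (X : choiceType) (D : lgraph X).
Local Notation W := (coxeter_group D).
Local Notation a := (coxeter_gen D).

Lemma of_word_cat u v : of_word (coxeter_relators D) (u ++ v) =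
  of_word _ u * of_word _ v :> W.
Proof. by rewrite [RHS]mul_of_word. Qed.

Lemma coxeter_genK x : a x * a x = 1.
Proof.
rewrite [LHS]mul_of_word; apply/of_wordP; apply: Wrel.
by left; exists x.
Qed.

Lemma coxeter_genV x : (a x)^-1 = a x.
Proof. by apply: (mulgI (a x)); rewrite mulgV coxeter_genK. Qed.

Lemma of_word_alternating x y k :
  of_word (coxeter_relators D) (alternating x y k) = (a x * a y) ^+ k.
Proof.
elim: k => [//|k IH].
rewrite expgS -IH -[a x * a y](of_word_cat [:: (x, false)] [:: (y, false)]).
by rewrite -of_word_cat.
Qed.

Lemma coxeter_braid x y m : x <> y -> label_of_edge (D x y) = Fin m ->
  (a x * a y) ^+ m = 1.
Proof.
move=> xy Dm; rewrite -of_word_alternating; apply/of_wordP; apply: Wrel.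
by right; exists x, y, m.
Qed.

Lemma of_word_gen x e : of_word (coxeter_relators D) [:: (x, e)] = a x.
Proof.
case: e => //; rewrite -coxeter_genV; apply: (mulgI (a x)).
rewrite mulgV [LHS]mul_of_word; apply/of_wordP; exact: (@Wcancel _ _ x false).
Qed.

End CoxeterGenerators.

(** * The exchange condition *)

Section Exchange.
Variables (X : choiceType) (D : lgraph X).
Local Notation W := (coxeter_group D).
Local Notation a := (coxeter_gen D).
Local Notation "[ 'elt' u ]" := (of_word (coxeter_relators D) u).

Lemma coxeter_gen_conjK x : involutive (fun t : W => a x * t * a x).
Proof. by move=> t; rewrite -!mulgA coxeter_genK mulg1 mulgA coxeter_genK mul1g. Qed.

Lemma coxeter_gen_conj_eq x (t s : W) :
  (a x * t * a x == s) = (t == a x * s * a x).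
Proof. exact: can2_eq (coxeter_gen_conjK x) (coxeter_gen_conjK x) t s. Qed.

(** In the action of a Coxeter group on signed reflections, a generator changes
    the sign of its own reflection only. All elements of the group are allowed
    in place of reflections, which saves a subtype. *)
Definition flip (x : X) (p : W * bool) : W * bool :=
  (a x * p.1 * a x, p.2 (+) (p.1 == a x)).

Lemma flipK x : involutive (flip x).
Proof.
case=> t e; rewrite /flip /= coxeter_gen_conjK coxeter_gen_conj_eq.
by rewrite coxeter_genK mul1g -addbA addbb addbF.
Qed.

Lemma iter_flip x y k t e :
  iter k (flip x \o flip y) (t, e) =
  ((a x * a y) ^+ k * t * ((a x * a y) ^+ k)^-1,
   e (+) \big[addb/false]_(0 <= i < k.*2) (t == (a y * a x) ^+ i * a y)).
Proof.
elim: k t e => [|k IH] t e.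
  by rewrite expg0 invg1 mul1g mulg1 big_geq // addbF.
rewrite iterSr [(flip x \o flip y) _]/= /flip /= IH; congr pair.
  by rewrite expgSr invgM [(_ * _)^-1 in RHS]invgM !coxeter_genV !mulgA.
rewrite doubleS big_nat_recl // big_nat_recl // -!addbA; congr addb.
rewrite expg0 mul1g expg1; congr addb; rewrite coxeter_gen_conj_eq; congr addb.
apply: eq_bigr => i _; rewrite !coxeter_gen_conj_eq; congr (t == _).
by rewrite expgS expgSr !mulgA.
Qed.

(** The reflections [(a y * a x) ^+ i * a y] repeat with period [m] in [i] by
    the braid relation, so each of them occurs an even number of times among
    the [2m] letters of a braid relator. *)
Lemma flip_braid x y m t : x <> y -> label_of_edge (D x y) = Fin m ->
  iter m (flip x \o flip y) t = t.
Proof.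
move=> xy /(coxeter_braid xy) xym; case: t => t e.
have yxm : (a y * a x) ^+ m = 1.
  rewrite -[a y * a x]invgK [(a y * a x)^-1]invgM !coxeter_genV.
  by rewrite expVgn xym invg1.
rewrite iter_flip xym invg1 mulg1 mul1g -addnn (@big_cat_nat _ _ _ m) ?leq_addr //=.
rewrite -[X in \big[_/_]_(X <= _ < m + m) _]add0n big_addn addnK.
have yx_periodic i : (a y * a x) ^+ (i + m) = (a y * a x) ^+ i.
  by rewrite expgnDr yxm mulg1.
under [X in _ (+) (_ (+) X)]eq_bigr => i _ do rewrite yx_periodic.
by rewrite addbb addbF.
Qed.

(** For a word [s_1 ... s_k] of [w], this is the parity of the number of [i]
    such that [t] is the conjugate of [s_i] by [s_(i+1) ... s_k]; for a reduced
    word it tells whether [w * t] is shorter than [w]. *)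
Definition inversion (w : W) (t : W) : bool :=
  (coxeter_action flip w (t, false)).2.

Lemma coxeter_action_flip w t e :
  coxeter_action flip w (t, e) = (w * t * w^-1, e (+) inversion w t).
Proof.
rewrite /inversion -(of_wordK w) !(coxeter_action_of_word flipK flip_braid).
elim: (repr w) e => [|[x s] u IH] e /=; first by rewrite invg1 mul1g mulg1 addbF.
rewrite -cat1s of_word_cat of_word_gen /flip /= (IH e) /=.
by have /(congr1 fst) /= -> := IH false; rewrite invgM coxeter_genV !mulgA addbA.
Qed.

Lemma inversionM v w t : inversion (v * w) t =
  inversion w t (+) inversion v (w * t * w^-1).
Proof.
rewrite {1}/inversion (coxeter_actionM flipK flip_braid).
by rewrite !coxeter_action_flip.
Qed.

Lemma inversion_gen x t : inversion (a x) t = (t == a x).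
Proof. by rewrite /inversion (coxeter_action_gen flipK flip_braid). Qed.

Lemma inversion1 t : inversion 1 t = false.
Proof. by rewrite /inversion (coxeter_action1 flipK flip_braid). Qed.

(** An inversion of a word is the conjugate of one of its letters by the letters
    after it, so that multiplying by this inversion deletes that letter. *)
Lemma exchange (u : word X) t : inversion [elt u] t ->
  exists2 v, (size v < size u)%N & [elt u] * t = [elt v].
Proof.
elim: u => [|[x s] u IH]; first by rewrite [inversion _ _]inversion1.
rewrite -cat1s of_word_cat of_word_gen inversionM inversion_gen.
case: (inversion _ t) IH => [IH _|_ /eqP ut].
  have [//|v vu utv] := IH; exists ((x, s) :: v) => //.
  by rewrite -mulgA utv -cat1s of_word_cat of_word_gen.
exists u => //=; rewrite -mulgA -[[elt u] * t](mulgVK [elt u]) ut.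
by rewrite mulgA coxeter_genK mul1g.
Qed.

(** * Intersections of standard parabolic subgroups *)

Definition standard_parabolic (J : set X) : set W := generated [set a x | x in J].

(** By the cocycle rule [inversionM], an inversion of a product is, up to
    conjugation by the second factor, an inversion of one of the factors; so the
    property passes from the generators to the subgroup. *)
Lemma standard_parabolic_inversion J w : standard_parabolic J w ->
  forall t, inversion w t -> standard_parabolic J t.
Proof.
have [J1 JM JV] : subgroup (standard_parabolic J) := generated_subgroup _.
move=> Jw; suff [_] : standard_parabolic J w /\
    forall t, inversion w t -> standard_parabolic J t.
  exact.
apply: (generated_sub
  (H := [set w | standard_parabolic J w /\
             forall t, inversion w t -> standard_parabolic J t]) _ _ Jw);
  last first.
  move=> _ [x Jx <-]; have Jax : standard_parabolic J (a x).
    by apply: sub_generated; exists x.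
  by split=> // t; rewrite inversion_gen => /eqP ->.
split=> [|v {Jw}w [Jv v_J] [Jw w_J]|v [Jv v_J]].
- by split=> // t; rewrite inversion1.
- split=> [|t]; first exact: JM.
  rewrite inversionM; case wt: (inversion w t); first by move=> _; exact: w_J.
  rewrite addFb => /v_J Jt.
  rewrite -[t](mulKg w) -[w * t](mulgVK w).
  by apply: (JM); [exact: JV | exact: JM].
- split=> [|t vt]; first exact: JV.
  have: inversion v (v^-1 * t * v^-1^-1).
    have := inversion1 t; rewrite -(mulgV v) inversionM vt.
    by case: (inversion _ _).
  move=> /v_J; rewrite invgK => Jt.
  rewrite -[t](mulVKg v) -[v^-1 * t](mulgK v).
  by apply: (JM) => //; apply: JM => //; exact: JV.
Qed.

End Exchange.

(** * The reflection representation *)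

Section Reflections.
Import GRing.Theory Num.Theory.
Local Open Scope ring_scope.

(** For a label [m], this says that [z] behaves as a primitive [2m]-th root of
    unity, such as [exp (i pi / m)]; [- (z + z^-1)] is then [- 2 cos (pi / m)].
    For the label [Infty] it says that no positive even power of [z] is 1. *)
Definition angle_root (l : label) (z : algC) : Prop :=
  z != 0 /\ forall k, (z ^+ k.*2 == 1) = (period l %| k)%N.

Lemma angle_root_exists l : label_ge2 l -> exists z, angle_root l z.
Proof.
case: l => [m|_] /=.
  move=> m2; have [|z zm] := @C_prim_root_exists m.*2; first by rewrite double_gt0 ltnW.
  exists z; split=> [|k].
    by rewrite (prim_root_eq0 zm) double_eq0 -lt0n ltnW.
  by rewrite -(prim_order_dvd zm) -!muln2 dvdn_pmul2r.
exists 2; split=> [|k]; first by rewrite pnatr_eq0.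
by rewrite dvd0n -natrX pnatr_eq1 -(expn0 2) eqn_exp2l // double_eq0.
Qed.

Lemma angle_root_sqr l z : label_ge2 l -> angle_root l z -> z ^+ 2 != 1.
Proof.
move=> l2 [_ /(_ 1%N)]; rewrite dvdn1 => ->.
by case: l l2 => [m|] //= m2; rewrite gtn_eqF.
Qed.

Variables (X : choiceType) (D : lgraph X) (z : label -> algC).
Hypothesis D_sym : forall x y, D x y = D y x.
Hypothesis D_ge2 : forall x y, x <> y -> label_ge2 (label_of_edge (D x y)).
Hypothesis zP : forall l, label_ge2 l -> angle_root l (z l).
Local Notation W := (coxeter_group D).
Local Notation a := (coxeter_gen D).

(** Twice the bilinear form of the reflection representation given by [z]. *)
Definition cartan (x y : X) : algC :=
  if x == y then 2 else
    let w := z (label_of_edge (D x y)) in - (w + w^-1).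

(** In the dual of the reflection representation no sum over the generators
    appears, so that arbitrary functions can be acted on. *)
Definition dual_reflection (x : X) (f : X -> algC) : X -> algC :=
  fun u => f u - cartan x u * f x.

Lemma dual_reflectionK x : involutive (dual_reflection x).
Proof. by move=> f; apply/funext => u; rewrite /dual_reflection /cartan eqxx; ring. Qed.

Section Rotation.
Variables (x y : X) (l : label).
Hypotheses (xy : x <> y) (Dl : label_of_edge (D x y) = l).
Let l2 : label_ge2 l. Proof. by rewrite -Dl; exact: D_ge2. Qed.

(** The functional [f |-> f x + w * f y] is an eigenvector, for the eigenvalue
    [w ^+ 2], of the transpose of the rotation. *)
Lemma rotation_eigen w (f : X -> algC) k : w = z l \/ w = (z l)^-1 ->
  iter k (dual_reflection x \o dual_reflection y) f x +
    w * iter k (dual_reflection x \o dual_reflection y) f y =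
  w ^+ k.*2 * (f x + w * f y).
Proof.
have [z0 _] := zP l2.
move=> wz; have w0 : w != 0 by case: wz => ->; rewrite ?invr_eq0.
have cxy : cartan x y = - (w + w^-1).
  rewrite /cartan Dl; have /eqP/negbTE -> := xy.
  by case: wz => ->; rewrite ?invrK // addrC.
have cyx : cartan y x = - (w + w^-1).
  rewrite -cxy /cartan D_sym eq_sym //.
elim: k => [|k IH]; first by rewrite expr0 mul1r.
rewrite doubleS !exprS iterS -!mulrA -IH.
move: (iter k _ f) => g; rewrite /comp /dual_reflection cxy cyx /cartan !eqxx.
by field.
Qed.

(** The two eigenvectors determine the coordinates at [x] and [y]; the other
    coordinates follow because each of them differs from an invariant of both
    reflections by a combination of these two. *)
Lemma rotation_fix k (f : X -> algC) : (period l %| k)%N ->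
  iter k (dual_reflection x \o dual_reflection y) f = f.
Proof.
have [z0 zl] := zP l2; have z1 := angle_root_sqr l2 (zP l2).
move=> lk; set g := iter k _ f.
have /eqP zk : z l ^+ k.*2 == 1 by rewrite zl.
have zVk : (z l)^-1 ^+ k.*2 = 1 by rewrite exprVn zk invr1.
have := rotation_eigen f k (or_introl (erefl (z l))).
have := rotation_eigen f k (or_intror (erefl (z l)^-1)).
rewrite -/g zk zVk !mul1r => e1 e2.
have z2 : z l ^+ 2 - 1 != 0 by rewrite subr_eq0.
have gy : g y = f y.
  apply/eqP; rewrite -subr_eq0 -(mulrI_eq0 _ (lregP z2)); apply/eqP.
  transitivity (z l * ((g x + z l * g y) - (g x + (z l)^-1 * g y)
                       - (f x + z l * f y) + (f x + (z l)^-1 * f y))).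
    by field.
  by rewrite e1 e2; ring.
have gx : g x = f x by move: e2; rewrite gy => /addIr.
apply/funext => u.
have cxy : cartan x y = - (z l + (z l)^-1).
  by rewrite /cartan Dl; have /eqP/negbTE -> := xy.
have cyx : cartan y x = cartan x y by rewrite /cartan D_sym eq_sym.
have c4 : 4 - cartan x y ^+ 2 != 0.
  rewrite cxy -(mulrI_eq0 _ (lregP (expf_neq0 2 z0))).
  have -> : z l ^+ 2 * (4 - (- (z l + (z l)^-1)) ^+ 2) = - (z l ^+ 2 - 1) ^+ 2.
    by field.
  by rewrite oppr_eq0 expf_neq0.
(* The coefficients below make [h u - p * h x - q * h y] invariant under both
   reflections; they solve a linear system of determinant [4 - c ^ 2]. *)
pose c := cartan x y.
pose p := (2 * cartan x u - c * cartan y u) / (4 - c ^+ 2).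
pose q := (2 * cartan y u - c * cartan x u) / (4 - c ^+ 2).
have inv n : iter n (dual_reflection x \o dual_reflection y) f u
    - p * iter n (dual_reflection x \o dual_reflection y) f x
    - q * iter n (dual_reflection x \o dual_reflection y) f y = f u - p * f x - q * f y.
  elim: n => [//|n <-]; rewrite iterS; move: (iter n _ f) => h.
  have c2 v : cartan v v = 2 by rewrite /cartan eqxx.
  by rewrite /comp /dual_reflection cyx !c2 /p /q /c; field.
by move: (inv k); rewrite -/g gx gy => /addIr/addIr.
Qed.
End Rotation.

Lemma dual_reflection_braid x y m (f : X -> algC) : x <> y ->
  label_of_edge (D x y) = Fin m -> iter m (dual_reflection x \o dual_reflection y) f = f.
Proof. by move=> xy Dm; apply: (rotation_fix xy Dm); exact: dvdnn. Qed.

(** A point of the closed fundamental chamber that lies on all walls but one;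
    its stabilizer separates [a x] from the other generators. *)
Definition delta (x u : X) : algC := (u == x)%:R.

Lemma dual_reflection_delta x y : dual_reflection x (delta y) = delta y <-> x <> y.
Proof.
split=> [fix_y xy|/eqP xy].
  have := congr1 (@^~ y) fix_y.
  rewrite xy /dual_reflection /delta /cartan !eqxx mulr1 => /eqP.
  by rewrite subr_eq addrC -subr_eq subrr eq_sym pnatr_eq0.
by apply/funext => u; rewrite /dual_reflection /delta (negbTE xy) mulr0 subr0.
Qed.

End Reflections.

(** * Consequences for Coxeter groups *)

Section CoxeterGroup.
Variables (X : choiceType) (D : lgraph X).
Hypothesis D_sym : forall x y, D x y = D y x.
Hypothesis D_ge2 : forall x y, x <> y -> label_ge2 (label_of_edge (D x y)).
Local Notation W := (coxeter_group D).
Local Notation a := (coxeter_gen D).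
Local Notation "[ 'elt' u ]" := (of_word (coxeter_relators D) u).

Lemma angle_root_choice :
  exists z : label -> algC, forall l, label_ge2 l -> angle_root l (z l).
Proof.
suff /boolp.choice[z zP] : forall l, exists w, label_ge2 l -> angle_root l w by exists z.
move=> l; have [l2|nl] := pselect (label_ge2 l).
  by have [w] := angle_root_exists l2; exists w.
by exists 0%R.
Qed.

(** The generators indexed by [J] fix [delta x] when [x] is not in [J], and [a x]
    does not. *)
Lemma coxeter_gen_standard_parabolic (J : set X) x : standard_parabolic J (a x) -> J x.
Proof.
have [z zP] := angle_root_choice.
have phiK := dual_reflectionK D z; have phi_braid := dual_reflection_braid D_sym D_ge2 zP.
move=> Jx; apply: contrapT => nJx.
have: coxeter_action (dual_reflection D z) (a x) (delta x) = delta x.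
  apply: (generated_sub (coxeter_action_stabilizer phiK phi_braid (delta x)) _ Jx).
  move=> _ [y Jy <-] /=; rewrite (coxeter_action_gen phiK phi_braid).
  by apply/dual_reflection_delta => yx; apply: nJx; rewrite -yx.
by rewrite (coxeter_action_gen phiK phi_braid) dual_reflection_delta.
Qed.

Lemma elt_order_coxeter_gen x : elt_order (a x) = Fin 2.
Proof.
apply/elt_order2P; split; last exact: coxeter_genK.
move=> ax1; apply: (@coxeter_gen_standard_parabolic set0 x); rewrite ax1.
by have [] := generated_subgroup [set a x | x in set0].
Qed.

Lemma elt_order_coxeter_gen2 x y : x <> y ->
  elt_order (a x * a y) = label_of_edge (D x y).
Proof.
have [z zP] := angle_root_choice.
have phiK := dual_reflectionK D z; have phi_braid := dual_reflection_braid D_sym D_ge2 zP.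
move=> xy; set l := label_of_edge _; have l2 : label_ge2 l by exact: D_ge2.
apply: elt_order_charact => [|k]; first by move=> l0; rewrite l0 in l2.
apply/eqP/idP => [xyk|/dvdnP[q ->]].
  have := coxeter_actionX phiK phi_braid (a x * a y) k (delta x).
  rewrite xyk (coxeter_action1 phiK phi_braid).
  rewrite (eq_iter (f' := dual_reflection D z x \o dual_reflection D z y)); last first.
    move=> f; rewrite (coxeter_actionM phiK phi_braid).
    by rewrite !(coxeter_action_gen phiK phi_braid).
  move=> fixk.
  have := rotation_eigen D_sym D_ge2 zP xy (erefl l) (delta x) k (or_introl (erefl _)).
  rewrite -fixk /delta eqxx eq_sym; have /eqP/negbTE -> := xy.
  rewrite GRing.mulr0 GRing.addr0 GRing.mulr1 => /esym/eqP.
  by have [_ ->] := zP _ l2.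
case lE: l l2 => [m|] _; last by rewrite muln0 expg0.
by rewrite mulnC expgnA (coxeter_braid xy lE) expg1n.
Qed.

(** By induction on the length of a word of [w]. If no word of [w] is shorter,
    the last letter [x] is an inversion of [w], by the exchange condition for
    the word without it; therefore [a x] is in every given subgroup, and so is
    the product of the other letters. *)
Lemma standard_parabolic_bigcap (I : Type) (P : set I) (J : I -> set X) (w : W) :
  (forall i, P i -> standard_parabolic (J i) w) ->
  standard_parabolic (\bigcap_(i in P) J i) w.
Proof.
rewrite -(of_wordK w); move: (repr w) => u.
have [k] := ubnP (size u); elim: k u => // k IH u uk uJ.
have [[v vu uv]|red] := pselect (exists2 v, (size v < size u)%N & [elt u] = [elt v]).
  by rewrite uv in uJ *; apply: IH uJ; exact: leq_trans vu _.
case/lastP: u uk uJ red => [|u [x e]] uk uJ red.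
  by have [] := generated_subgroup [set a x | x in \bigcap_(i in P) J i].
move: uJ red uk; rewrite -cats1 of_word_cat of_word_gen cats1 size_rcons ltnS.
move=> uJ red uk.
have inv_x : inversion ([elt u] * a x) (a x).
  rewrite inversionM inversion_gen eqxx coxeter_genK mul1g coxeter_genV addTb.
  apply/negP => /exchange[v vu uv]; apply: red; exists v => //; exact: ltnW.
have Jx i : P i -> J i x.
  move=> Pi; apply: coxeter_gen_standard_parabolic.
  exact: (standard_parabolic_inversion (uJ i Pi) inv_x).
have [_ JM _] := generated_subgroup [set a x | x in \bigcap_(i in P) J i].
apply: JM; last by apply: sub_generated; exists x.
apply: IH => // i Pi.
have [_ JiM _] := generated_subgroup [set a x | x in J i].
rewrite -[[elt u]](mulgK (a x)) coxeter_genV.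
by apply: JiM; [exact: uJ | apply: sub_generated; exists x => //; exact: Jx].
Qed.

End CoxeterGroup.

(** * Orders in semidirect products *)

Section SemidirectOrders.
Variables (B A : groupType) (eta : aut_action B A).
Local Notation G := (sdprod eta).

Lemma sdprod_mulE (x y : A) (b c : B) :
  ((x, b) : G) * ((y, c) : G) = (x * eta b y, b * c).
Proof. by []. Qed.

Lemma sdprod_expl (x : A) k : ((x, 1) : G) ^+ k = (x ^+ k, 1).
Proof.
elim: k => [//|k IH]; rewrite !expgS IH.
by rewrite sdprod_mulE aut_act1 mulg1.
Qed.

Lemma sdprod_expr (b : B) k : ((1, b) : G) ^+ k = (1, b ^+ k).
Proof.
elim: k => [//|k IH]; rewrite !expgS IH.
by rewrite sdprod_mulE aut_actr1 mulg1.
Qed.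

Lemma elt_order_sdprodl (x : A) : elt_order ((x, 1) : G) = elt_order x.
Proof.
by apply: eq_elt_order => k; rewrite sdprod_expl; apply/eqP/eqP => [[]|->].
Qed.

Lemma elt_order_sdprodr (b : B) : elt_order ((1, b) : G) = elt_order b.
Proof.
by apply: eq_elt_order => k; rewrite sdprod_expr; apply/eqP/eqP => [[]|->].
Qed.

(** Odd powers project to [b <> 1], while the square lies in the left factor. *)
Lemma elt_order_sdprod_involution (x : A) (b : B) : b <> 1 -> b * b = 1 ->
  elt_order ((x, b) : G) = double_label (elt_order (x * eta b x)).
Proof.
move=> b1 bb; have sqr : ((x, b) : G) ^+ 2 = (x * eta b x, 1).
  by rewrite expg2 sdprod_mulE bb.
have even_exp k : ((x, b) : G) ^+ k.*2 = ((x * eta b x) ^+ k, 1).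
  by rewrite -muln2 mulnC expgnA sqr sdprod_expl.
apply: elt_order_charact => [|k].
  by case: elt_order (@elt_order_neq0 _ (x * eta b x)) => // -[|m].
rewrite period_double -{1}(odd_double_half k) expgnDr even_exp.
case ok: (odd k).
  transitivity false.
    apply/negbTE/eqP; rewrite expg1 sdprod_mulE => /(congr1 snd) /=.
    by rewrite mulg1.
  apply/esym/negbTE/negP => dk; have: ~~ odd k; last by rewrite ok.
  by rewrite -dvdn2; apply: dvdn_trans dk; rewrite -muln2 dvdn_mull.
rewrite expg0 mul1g -{2}(even_halfK (negbT ok)) -!muln2 dvdn_pmul2r //.
by rewrite -elt_order_period; apply/eqP/eqP => [[]|->].
Qed.

End SemidirectOrders.

(** * Distinguished generators of a regular hypertope *)

Section Hypertope.
Variables (B : groupType) (I : Type) (beta : coset_system B I).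

Lemma left_coset_id (H : set B) c : subgroup H -> H c -> left_coset c H = H.
Proof.
move=> [_ HM HV] Hc; apply/seteqP; split=> [_ [h Hh <-]|h Hh]; first exact: HM.
by exists (c^-1 * h); [apply: (HM) => //; exact: HV | rewrite mulVKg].
Qed.

Lemma coset_meets_base i (F : cosetsType beta i) :
  val F `&` beta i !=set0 -> val F = beta i.
Proof.
have sg := maxparabolic_subgroup beta i; have [_ HM HV] := sg.
case=> x [Fx ix]; have [c _ eF] := set_mem (valP F).
move: Fx; rewrite -eF => -[h ih hx]; apply: left_coset_id => //.
by rewrite -[c](mulgK h) hx; apply: (HM) => //; exact: HV.
Qed.

Lemma act_base i c : act c (base beta i) = base beta i <-> beta i c.
Proof.
have sg := maxparabolic_subgroup beta i; have [i1 _ _] := sg.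
split=> [/(congr1 val) /= e|ic]; last by apply/val_inj/left_coset_id.
by rewrite -e; exists 1 => //; rewrite mulg1.
Qed.

(** Let [F] be the base chamber without its element of type [i]. By thinness,
    [F] is contained in one other chamber; an element of [B] that maps the base
    chamber to it moves the base element of type [i] and fixes [F]; so it is a
    nontrivial element of the group generated by [b i], that is [b i]. *)
Lemma distinguished_notin (b : I -> B) i : regular_hypertope beta ->
  distinguished_generators beta b -> ~ beta i (b i).
Proof.
move=> [_ beta_thin _ beta_trans _] hb ibi.
have beta1 k : beta k 1 by have [] := maxparabolic_subgroup beta k.
pose is_base (x : coset_incidence beta) := val (projT2 x) = beta (projT1 x).
pose e k : coset_incidence beta := existT _ k (base beta k).
pose F : set (coset_incidence beta) := [set x | projT1 x <> i /\ is_base x].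
have base_incident x y : is_base x -> is_base y -> incident x y.
  by move=> bx byy; exists 1; rewrite /= bx byy.
have flagF : flag F by move=> x y [_ bx] [_ byy]; exact: base_incident.
have cotypeF : cotype F = [set i].
  apply/seteqP; split=> k; rewrite /cotype /=.
    by move=> nk; apply: contrapT => ki; apply: nk; exists (e k).
  by move=> -> [x [xi _]].
have resF x : residue F x -> projT1 x = i.
  case: x => k x [nF inc]; apply: contrapT => ki; apply: nF; split=> //.
  by apply: coset_meets_base; exact: (inc (e k)).
have [z zF ze] : exists2 z, residue F z & z <> e i.
  have [x [y [xy resE]]] := beta_thin F i flagF cotypeF.
  have: residue F (e i) by split=> [[]|y' [_ by']] //; exact: base_incident.
  rewrite resE => -[ex|ey]; [exists y | exists x]; rewrite ?ex ?ey //.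
  - by right.
  - by move=> yx; apply: xy.
  - by left.
have incC (x y : coset_incidence beta) : incident x y -> incident y x.
  by move=> [u [ux uy]]; exists u.
have [c cE] : exists c, act_elt c @` [set x | is_base x] = [set x | F x \/ x = z].
  have zi := resF _ zF; have [_ zinc] := zF.
  apply: beta_trans.
  - by move=> x y; exact: base_incident.
  - move=> x y [Fx|->] [Fy|->]; [exact: flagF|exact/incC/zinc|exact: zinc|].
    have [d _ zd] := set_mem (valP (projT2 z)).
    have: val (projT2 z) d by rewrite -zd; exists 1 => //; rewrite mulg1.
    by exists d.
  - apply/seteqP; split=> k _; last by exists (e k).
    have [ki|ki] := pselect (k = i); first by exists z; [right | rewrite ki].
    by exists (e k) => //; left.
have c_e k : F (act_elt c (e k)) \/ act_elt c (e k) = z.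
  have: (act_elt c @` [set x | is_base x]) (act_elt c (e k)) by exists (e k).
  by rewrite cE.
have : parabolic beta [set k | k <> i] c.
  move=> k ki; apply/act_base/val_inj.
  have [[_ //]|/(congr1 (@projT1 _ _)) /= kz] := c_e k.
  by case: ki; rewrite /= kz; exact: resF.
have [bi2 ->] := hb i; have [_ bb] := (elt_order2P _).1 bi2.
move=> /(generated_involution bb) cb.
have ic : beta i c by case: cb => ->.
have [[]//|] := c_e i.
by rewrite /act_elt /= ((act_base _ _).2 ic) => /esym.
Qed.

End Hypertope.

(** * The diagram of the twisting *)

Section TwistingDiagram.
Variables (B : groupType) (I : Type) (beta : coset_system B I) (j : I).
Variable lambda : set (set (cosetsType beta j)) -> label.
Hypothesis hlambda : label_function lambda.
Local Notation D := (diagonal_graph lambda).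
Local Notation a := (coxeter_gen D).
Local Notation o := (base beta j).

Lemma edge_of_labelK : cancel edge_of_label label_of_edge.
Proof. by case=> [[|[|[|m]]]|]. Qed.

Lemma diagonal_label F1 F2 : F1 <> F2 ->
  label_of_edge (D F1 F2) = lambda (diagonal_class F1 F2).
Proof.
by rewrite /diagonal_graph => /eqP/negbTE ->; exact: edge_of_labelK.
Qed.

Lemma diagonal_graph_sym F1 F2 : D F1 F2 = D F2 F1.
Proof.
rewrite /diagonal_graph eq_sym (_ : diagonal_class F1 F2 = diagonal_class F2 F1) //.
by rewrite /diagonal_class; apply: eq_imagel => b _; exact: setUC.
Qed.

Lemma diagonal_graph_ge2 F1 F2 : F1 <> F2 -> label_ge2 (label_of_edge (D F1 F2)).
Proof. by move=> F12; rewrite diagonal_label //; apply: hlambda; exists F1, F2. Qed.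

Lemma parabolic_alpha (J : set (cosetsType beta j)) (x : twistA lambda) :
  parabolic (alpha lambda) (~` J) x -> standard_parabolic J x.
Proof.
move=> Jx; rewrite -[J](_ : \bigcap_(F in ~` J) [set E | E <> F] = J).
  apply: (standard_parabolic_bigcap diagonal_graph_sym diagonal_graph_ge2).
  exact: Jx.
apply/seteqP; split=> [E hE|E JE F nF /= EF]; last by apply: nF; rewrite -EF.
by apply: contrapT => nE; exact: (hE E nE).
Qed.


Variable b : I -> B.
Hypothesis b_gen : distinguished_generators beta b.
Hypothesis b_notin : forall i, ~ beta i (b i).
Local Notation G := (twistG lambda).

Definition twist_gen (t : option I) : G :=
  if t is Some i then (1, b i) else (a o, 1).

Lemma distinguished_in i k : i <> k -> beta k (b i).
Proof.
move=> ik; have [_ bE] := b_gen i.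
have: parabolic beta [set k | k <> i] (b i) by rewrite bE; exact: sub_generated.
by apply=> /= ki; apply: ik.
Qed.

Lemma distinguishedK i : b i <> 1 /\ b i * b i = 1.
Proof. by have [/elt_order2P] := b_gen i. Qed.

Lemma parabolic_base c : parabolic beta setT c -> c = 1.
Proof.
move=> betac; have [_ bb] := distinguishedK j; have [_ bE] := b_gen j.
have: parabolic beta [set k | k <> j] c by move=> k _; exact: betac.
rewrite bE => /(generated_involution bb)[//|cj].
by case: (b_notin (i := j)); rewrite -cj; exact: betac.
Qed.

Lemma coset_orbit_base : coset_orbit (beta j) o = [set o].
Proof.
apply/seteqP; split=> [_ [c jc <-]|_ ->]; first exact/act_base.
by exists 1; [have [] := maxparabolic_subgroup beta j | rewrite act1].
Qed.

Lemma elt_order_twist_gen t : elt_order (twist_gen t) = Fin 2.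
Proof.
case: t => [i|]; rewrite /= ?elt_order_sdprodl ?elt_order_sdprodr.
  by have [] := b_gen i.
exact: (elt_order_coxeter_gen diagonal_graph_sym diagonal_graph_ge2).
Qed.

(** For the type [Some i], the left components lie in all maximal parabolic
    subgroups of the Coxeter group, so they are trivial, and the right ones form
    the subgroup generated by [b i]. For the type [None], the left components
    lie in the maximal parabolic subgroups at all elements but the base one,
    hence in the subgroup of order 2 at the base element, and the right ones fix
    the base chamber, so they are trivial. *)
Lemma twist_gen_distinguished : distinguished_generators (twisting lambda) twist_gen.
Proof.
move=> t; split; first exact: elt_order_twist_gen.
have /elt_order2P[_ gg] := elt_order_twist_gen t.
apply/seteqP; split=> [[x c] xc|]; last first.
  apply: generated_sub; first exact: parabolic_subgroup.
  move=> _ ->; case: t {gg} => [i|] [k|] //= ki.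
  - split=> /=.
      by have [] := parabolic_subgroup (alpha lambda) (~` coset_orbit (beta k) o).
    by apply: distinguished_in => ik; apply: ki; rewrite ik.
  - by split=> //=; have [] := parabolic_subgroup (alpha lambda) setT.
  - have [k1 _ _] := maxparabolic_subgroup beta k; split=> //= F nF.
    apply: sub_generated; exists o => //= oF; apply: nF; exists 1 => //.
    by rewrite act1.
suff [->|->] : (x, c) = 1 :> G \/ (x, c) = twist_gen t :> G.
- by have [] := generated_subgroup [set twist_gen t].
- exact: sub_generated.
case: t {gg} xc => [i|] xc.
  have [xT _] : twisting lambda None (x, c) by apply: xc.
  have x1 : x = 1.
    have x0 : standard_parabolic set0 x by apply: parabolic_alpha; rewrite setC0.
    apply: (generated_sub (H := [set 1]) _ _ x0); last by move=> y [].
    by split=> [//|y z -> ->|y ->] /=; rewrite ?mulg1 ?invg1.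
  have : parabolic beta [set k | k <> i] c.
    by move=> k ki; have [] : twisting lambda (Some k) (x, c) by apply: xc => -[].
  have [_ ->] := b_gen i; have [_ bb] := distinguishedK i.
  by move=> /(generated_involution bb)[->|->]; rewrite x1; [left | right].
have x_gen : standard_parabolic [set o] x.
  apply: parabolic_alpha; rewrite -coset_orbit_base.
  by have [] : twisting lambda (Some j) (x, c) by apply: xc.
have c1 : c = 1.
  apply: parabolic_base => k _.
  by have [] : twisting lambda (Some k) (x, c) by apply: xc.
move: x_gen; rewrite /standard_parabolic image_set1.
by move=> /(generated_involution (coxeter_genK D o))[->|->]; rewrite c1; [left | right].
Qed.

Lemma elt_order_twist_gen_base i :
  elt_order (twist_gen None * twist_gen (Some i)) =
  double_label (elt_order (a o * a (act (b i) o) : twistA lambda)).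
Proof.
have [b1 bb] := distinguishedK i.
rewrite sdprod_mulE mul1g aut_actr1 mulg1 elt_order_sdprod_involution //.
by rewrite eta_gen.
Qed.

End TwistingDiagram.

Theorem corollary3p8 (n : nat) (B : groupType) (beta : coset_system B 'I_n)
    (b : 'I_n -> B) (j : 'I_n) (lambda : set (set (cosetsType beta j)) -> label)
    (hbeta : regular_hypertope beta)
    (hb : distinguished_generators beta b)
    (hfin : finite_set (cosets beta j))
    (htwo : exists F1 F2 : cosetsType beta j, F1 <> F2)
    (hlambda : label_function lambda) :
  exists g : option 'I_n -> twistG lambda,
    distinguished_generators (twisting lambda) g /\
    g None = (coxeter_gen (diagonal_graph lambda) (base beta j), 1%g) /\
    forall s t : option 'I_n,
      coxeter_diagram g s t =
      add_vertex (coxeter_diagram b) j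
        (double_label
           (lambda (diagonal_class (base beta j) (act (b j) (base beta j))))) s t.
Proof.
have b_notin i : ~ beta i (b i) by exact: distinguished_notin.
exists (twist_gen lambda b); split; first exact: twist_gen_distinguished.
split=> //; have moved : base beta j <> act (b j) (base beta j).
  by move=> /esym/act_base/b_notin.
set l := lambda _; have l2 : label_ge2 l.
  by apply: hlambda; exists (base beta j), (act (b j) (base beta j)).
have edge k : edge_of_label
    (elt_order (twist_gen lambda b None * twist_gen lambda b (Some k))) =
    if k == j then Some (double_label l) else None.
  rewrite (elt_order_twist_gen_base lambda hb); case: eqP => [->|kj].
    rewrite (elt_order_coxeter_gen2 (@diagonal_graph_sym _ _ _ _ _)
      (diagonal_graph_ge2 hlambda) moved).
    (* An edge is not omitted: twice a label that is at least 2 is never 2. *)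
    by rewrite diagonal_label // -/l; case: l l2 => [[|[|[|m]]]|].
  have /act_base -> := distinguished_in hb kj.
  rewrite coxeter_genK (_ : elt_order 1 = Fin 1) //.
  by apply: elt_order_charact => // m; rewrite expg1n eqxx dvd1n.
case=> [i|] [k|] //=; rewrite /coxeter_diagram //=.
- rewrite (inj_eq (@Some_inj _)); case: eqP => // _; congr edge_of_label.
  by rewrite sdprod_mulE aut_actr1 mulg1 elt_order_sdprodr.
- by rewrite elt_order_mulC edge.
- exact: edge.
Qed.
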